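(* Let $\mathcal{RS}$ be a Riemann solver for a node $J$ with two incoming arcs (indices $1,2$) and two outgoing arcs (indices $3,4$), with flux $f$, and let $(\bar\rho_1,\bar\rho_2,\bar\rho_3,\bar\rho_4)$ be an equilibrium for $\mathcal{RS}$ with $\bar\rho_1\le\bar\rho_2$ and $\bar\rho_3\le\bar\rho_4$. Assume that the equilibrium is composed of three good data and one bad datum. 1. Assume that the bad datum is in an incoming arc, i.e. $\bar\rho_1<\sigma$. If $\mathcal F(\mathcal{RS}(\rho_{1,0},\dots,\rho_{4,0}),k)\ge0$ for every initial datum $(\rho_{1,0},\dots,\rho_{4,0})\in[0,1]^4$ and every $k\in[0,1]$, then $\bar\rho_2=\sigma$ and both $\bar\rho_3$ and $\bar\rho_4$ belong to $[\bar\rho_1,\sigma]$. Conversely, if $\bar\rho_2=\sigma$ and both $\bar\rho_3$ and $\bar\rho_4$ belong to $[\bar\rho_1,\sigma]$, then $\mathcal F(\bar\rho_1,\bar\rho_2,\bar\rho_3,\bar\rho_4,k)\ge0$ for every $k\in[0,1]$. 2. Assume that the bad datum is in an outgoing arc, i.e. $\bar\rho_4>\sigma$. If $\mathcal F(\mathcal{RS}(\rho_{1,0},\dots,\rho_{4,0}),k)\ge0$ for every initial datum $(\rho_{1,0},\dots,\rho_{4,0})\in[0,1]^4$ and every $k\in[0,1]$, then $\bar\rho_3=\sigma$ and both $\bar\rho_1$ and $\bar\rho_2$ belong to $[\sigma,\bar\rho_4]$. Conversely, if $\bar\rho_3=\sigma$ and both $\bar\rho_1$ and $\bar\rho_2$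 belong to $[\sigma,\bar\rho_4]$, then $\mathcal F(\bar\rho_1,\bar\rho_2,\bar\rho_3,\bar\rho_4,k)\ge0$ for every $k\in[0,1]$.
   Context: Flux: $f:[0,1]\to\mathbb R$ is a continuous, piecewise smooth, concave function with $f(0)=f(1)=0$, and there is a unique $\sigma\in\,]0,1[$ such that $f$ is strictly increasing on $[0,\sigma[$ and strictly decreasing on $]\sigma,1]$. Let $\tau:[0,1]\to[0,1]$ be the map with $f(\tau(\rho))=f(\rho)$ for all $\rho\in[0,1]$ and $\tau(\rho)\neq\rho$ for all $\rho\ne\sigma$. Convention: $\mathrm{sgn}(0)=0$. Riemann solver (two incoming, two outgoing arcs): a function $\mathcal{RS}:[0,1]^4\to[0,1]^4$, $(\rho_{1,0},\dots,\rho_{4,0})\mapsto(\bar\rho_1,\dots,\bar\rho_4)$, such that for every initial datum: (1) $f(\bar\rho_1)+f(\bar\rho_2)=f(\bar\rho_3)+f(\bar\rho_4)$; (2) for $i\in\{1,2\}$ the classical Riemann problem for $\rho_t+f(\rho)_x=0$ with left state $\rho_{i,0}$ and right state $\bar\rho_i$ is solved with waves with negative speed; that is, $\bar\rho_i\in\{\rho_{i,0}\}\cup\,]\tau(\rho_{i,0}),1]$ if $\rho_{i,0}\le\sigma$ and $\bar\rho_i\in[\sigma,1]$ if $\rho_{i,0}\ge\sigma$; (3) for $j\in\{3,4\}$ the classical Riemann problem with left state $\bar\rho_j$ and right state $\rho_{j,0}$ is solved with waves with positive speed; that is, $\bar\rho_j\in[0,\sigma]$ if $\rho_{j,0}\le\sigma$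 and $\bar\rho_j\in\{\rho_{j,0}\}\cup[0,\tau(\rho_{j,0})[$ if $\rho_{j,0}\ge\sigma$. An equilibrium for $\mathcal{RS}$ is a fixed point of $\mathcal{RS}$. Good and bad data: a datum $\rho$ in an incoming arc is good if $\rho\in[\sigma,1]$ and bad if $\rho\in[0,\sigma[$; a datum $\rho$ in an outgoing arc is good if $\rho\in[0,\sigma]$ and bad if $\rho\in\,]\sigma,1]$. Entropy-flux function: $\mathcal F(\rho_1,\rho_2,\rho_3,\rho_4,k)=\sum_{i=1}^2\mathrm{sgn}(\rho_i-k)(f(\rho_i)-f(k))-\sum_{j=3}^4\mathrm{sgn}(\rho_j-k)(f(\rho_j)-f(k))$. (E1): $\mathcal{RS}$ satisfies (E1) if $\mathcal F(\mathcal{RS}(\rho_{1,0},\dots,\rho_{4,0}),k)\ge0$ for every initial datum $(\rho_{1,0},\dots,\rho_{4,0})\in[0,1]^4$ and every $k\in[0,1]$. *)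

(* Defs.v *)
From HB Require Import structures.
From mathcomp Require Import all_boot all_order all_algebra.
From mathcomp Require Import all_classical all_reals all_analysis.

Set Implicit Arguments.
Unset Strict Implicit.
Unset Printing Implicit Defensive.

Import Order.TTheory GRing.Theory Num.Theory.
Import numFieldNormedType.Exports.

Local Open Scope classical_set_scope.
Local Open Scope ring_scope.

(* Functions on [0, 1] are total functions on R whose values outside [0, 1]
   are never constrained; every hypothesis and conclusion is relativized to
   [0, 1]. *)

(* C^oo on the open pieces of a finite subdivision of [a, b]. No one-sided
   derivatives are required at the nodes, so this is the most permissive
   reading: it also allows sqrt (x * (1 - x)). Iterated derivatives only depend
   on germs, hence not on the values of f outside the piece. *)
Definition piecewise_smooth (R : realType) (a b : R) (f : R -> R) : Prop :=
  exists2 s : seq R, itv_partition a b s &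
    forall i, (i < size s)%N ->
      {in `]nth b (a :: s) i, nth b s i[, forall x : R,
        forall n : nat, derivable (derive1n n f) x 1}.

Definition concave_on (R : realType) (A : set R) (f : R -> R) : Prop :=
  convex_function (A : set R^o) (fun x => - f x).

Definition unimodal_at (R : realType) (f : R -> R) (sigma : R) : Prop :=
  [/\ sigma \in `]0, 1[,
      {in `[0, sigma[ &, {homo f : x y / x < y}} &
      {in `]sigma, 1] &, {homo f : x y /~ x < y}}].

Record is_flux (R : realType) (f : R -> R) (sigma : R) : Prop := IsFlux {
  flux_continuous : {within `[0, 1], continuous f};
  flux_smooth : piecewise_smooth 0 1 f;
  flux_concave : concave_on `[0, 1] f;
  flux0 : f 0 = 0;
  flux1 : f 1 = 0;
  flux_unimodal : unique (unimodal_at f) sigma }.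

Definition is_tau (R : realType) (f : R -> R) (sigma : R) (tau : R -> R) : Prop :=
  {in `[0, 1], forall r : R,
    [/\ tau r \in `[0, 1], f (tau r) = f r & r != sigma -> tau r != r]}.

(* One density per arc: 1 and 2 are incoming, 3 and 4 outgoing. *)
Record node_data (R : Type) := NodeData {
  rho1 : R; rho2 : R; rho3 : R; rho4 : R }.

Definition in_unit (R : realType) (r : node_data R) : Prop :=
  [/\ rho1 r \in `[0, 1], rho2 r \in `[0, 1],
      rho3 r \in `[0, 1] & rho4 r \in `[0, 1]].

(* r is an admissible trace for the initial datum r0 in an incoming arc: the
   waves from r0 to r have negative speed. *)
Definition admissible_in (R : realType) (sigma : R) (tau : R -> R) (r0 r : R)
    : Prop :=
  (r0 <= sigma -> r = r0 \/ r \in `]tau r0, 1]) /\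
  (sigma <= r0 -> r \in `[sigma, 1]).

(* Outgoing arc: the waves from r to r0 have positive speed. *)
Definition admissible_out (R : realType) (sigma : R) (tau : R -> R) (r0 r : R)
    : Prop :=
  (r0 <= sigma -> r \in `[0, sigma]) /\
  (sigma <= r0 -> r = r0 \/ r \in `[0, tau r0[).

Definition riemann_solver (R : realType) (f : R -> R) (sigma : R)
    (tau : R -> R) (RS : node_data R -> node_data R) : Prop :=
  forall r0 : node_data R, in_unit r0 ->
  let r := RS r0 in
  [/\ in_unit r,
      f (rho1 r) + f (rho2 r) = f (rho3 r) + f (rho4 r),
      admissible_in sigma tau (rho1 r0) (rho1 r) /\
      admissible_in sigma tau (rho2 r0) (rho2 r) &
      admissible_out sigma tau (rho3 r0) (rho3 r) /\
      admissible_out sigma tau (rho4 r0) (rho4 r)].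

Definition equilibrium (R : realType) (RS : node_data R -> node_data R)
    (r : node_data R) : Prop :=
  in_unit r /\ RS r = r.

Definition good_in (R : realType) (sigma r : R) : bool := r \in `[sigma, 1].
Definition bad_in (R : realType) (sigma r : R) : bool := r \in `[0, sigma[.
Definition good_out (R : realType) (sigma r : R) : bool := r \in `[0, sigma].
Definition bad_out (R : realType) (sigma r : R) : bool := r \in `]sigma, 1].

Definition num_good (R : realType) (sigma : R) (r : node_data R) : nat :=
  (good_in sigma (rho1 r) + good_in sigma (rho2 r) +
   good_out sigma (rho3 r) + good_out sigma (rho4 r))%N.

Definition num_bad (R : realType) (sigma : R) (r : node_data R) : nat :=
  (bad_in sigma (rho1 r) + bad_in sigma (rho2 r) +
   bad_out sigma (rho3 r) + bad_out sigma (rho4 r))%N.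

Definition entropy_flux (R : realType) (f : R -> R) (r : node_data R) (k : R)
    : R :=
  let q (x : R) := Num.sg (x - k) * (f x - f k) in
  (q (rho1 r) + q (rho2 r)) - (q (rho3 r) + q (rho4 r)).

Definition E1 (R : realType) (f : R -> R) (RS : node_data R -> node_data R)
    : Prop :=
  forall (r0 : node_data R) (k : R), in_unit r0 -> k \in `[0, 1] ->
    0 <= entropy_flux f (RS r0) k.

(* Main.v *)
Require Import Defs.
From mathcomp Require Import all_boot all_order all_algebra.
From mathcomp Require Import all_classical all_reals all_analysis.
From mathcomp Require Import lra.

(** Everything follows from two facts: [f] is strictly increasing on [[0, sigma]]
    and strictly decreasing on [[sigma, 1]], and mass is conserved,
    [f1 + f2 = f3 + f4], where [fi] is the value of [f] at the density of
    arc [i].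

    Necessity uses the single entropy level [k = sigma].  There the sign of each
    term is decided by the good/bad status of the datum, and conservation
    collapses the entropy flux to [2 (f2 - f sigma)] when the bad datum is the
    incoming [rho1], and to [2 (f3 - f sigma)] when it is the outgoing [rho4].
    As [sigma] is the strict maximum point of [f] ([flux_lt_max]), the
    corresponding good datum equals [sigma].  Conservation then reads
    [f1 + f sigma = f3 + f4] (resp. [f1 + f2 = f sigma + f4]), so the remaining
    flux values are squeezed between the bad one and the maximum, and
    monotonicity of [f] transfers this to the densities.

    For sufficiency the four densities lie on one monotone branch of [f].  When
    [k] is on the other side of [sigma], all the signs agree and the entropy flux
    vanishes by conservation.  When [k] is on the same branch, each term is
    [`|f x - f k|] up to a sign common to the branch, and the inequality is
    convexity of the absolute value: two numbers spread further apart with the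
    same sum have a larger total distance to [f k] ([dist_majorization]). *)

Import Order.TTheory GRing.Theory Num.Theory.
Import numFieldNormedType.Exports.

Local Open Scope classical_set_scope.
Local Open Scope ring_scope.

Lemma continuous_ge_endpoints (R : realType) (f : R -> R) (a b c : R) :
  a < b -> {within `[a, b], continuous f} ->
  {in `]a, b[, forall x, c <= f x} -> c <= f a /\ c <= f b.
Proof.
move=> ab /(continuous_within_itvP _ ab) [_ fa fb] cf; split.
- apply: (cvgr_to_ge fa); near=> x; apply: cf; rewrite in_itv /=.
  by apply/andP; split; near: x; [exact: nbhs_right_gt | exact: nbhs_right_lt].
- apply: (cvgr_to_ge fb); near=> x; apply: cf; rewrite in_itv /=.
  by apply/andP; split; near: x; [exact: nbhs_left_gt | exact: nbhs_left_lt].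
Unshelve. all: by end_near. Qed.

(** The branches of a flux are strictly monotone only on half-open intervals by
    hypothesis; the gap at [sigma] is closed by continuity.  Strictness survives
    the limit because the midpoint of [x] and [sigma] is compared with [sigma]
    instead of [x]. *)
Lemma flux_lt_max (R : realType) (f : R -> R) (sigma x : R) :
  is_flux f sigma -> x \in `[0, 1] -> x != sigma -> f x < f sigma.
Proof.
case=> fc _ _ _ _ [[]]; rewrite in_itv /= => /andP[s0 s1] incr decr _.
rewrite in_itv /= => /andP[x0 x1]; rewrite neq_lt => /orP[xs|sx].
- pose m := (x + sigma) / 2.
  have xm : x < m by rewrite /m; lra.
  have ms : m < sigma by rewrite /m; lra.
  apply: (@lt_le_trans _ _ (f m)).
    by apply: incr => //; rewrite in_itv /=; lra.
  have fms : {within `[m, sigma], continuous f}.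
    apply: continuous_subspaceW fc => z; rewrite /= !in_itv /=; lra.
  apply: (proj2 (@continuous_ge_endpoints _ f m sigma _ ms fms _)) => z.
  rewrite in_itv /= => /andP[mz zs]; apply/ltW/incr => //; rewrite in_itv /=; lra.
- pose m := (x + sigma) / 2.
  have mx : m < x by rewrite /m; lra.
  have sm : sigma < m by rewrite /m; lra.
  apply: (@lt_le_trans _ _ (f m)).
    by apply: decr => //; rewrite in_itv /=; lra.
  have fsm : {within `[sigma, m], continuous f}.
    apply: continuous_subspaceW fc => z; rewrite /= !in_itv /=; lra.
  apply: (proj1 (@continuous_ge_endpoints _ f sigma m _ sm fsm _)) => z.
  rewrite in_itv /= => /andP[sz zm]; apply/ltW/decr => //; rewrite in_itv /=; lra.
Qed.

Lemma flux_le_max (R : realType) (f : R -> R) (sigma x : R) :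
  is_flux f sigma -> x \in `[0, 1] -> f x <= f sigma.
Proof.
move=> fl x01; have [->//|xs] := eqVneq x sigma.
exact/ltW/flux_lt_max.
Qed.

Lemma flux_max_unique (R : realType) (f : R -> R) (sigma x : R) :
  is_flux f sigma -> x \in `[0, 1] -> f sigma <= f x -> x = sigma.
Proof.
move=> fl x01; have [//|xs] := eqVneq x sigma.
by rewrite leNgt flux_lt_max.
Qed.

Lemma flux_le_left (R : realType) (f : R -> R) (sigma : R) :
  is_flux f sigma -> {in `[0, sigma] &, {mono f : x y / x <= y}}.
Proof.
move=> fl; apply: le_mono_in => x y; rewrite !in_itv /=.
have [[+ incr _] _] := flux_unimodal fl.
rewrite in_itv /= => /andP[s0 s1].
move=> /andP[x0 xs] /andP[y0 ys] xy.
move: ys; rewrite le_eqVlt => /orP[/eqP ys|ys].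
  by rewrite ys; apply: flux_lt_max; rewrite // ?in_itv /=; lra.
by apply: incr => //; rewrite in_itv /=; lra.
Qed.

Lemma flux_le_right (R : realType) (f : R -> R) (sigma : R) :
  is_flux f sigma -> {in `[sigma, 1] &, {mono f : x y /~ x <= y}}.
Proof.
move=> fl; apply: le_nmono_in => x y; rewrite !in_itv /=.
have [[+ _ decr] _] := flux_unimodal fl.
rewrite in_itv /= => /andP[s0 s1].
move=> /andP[sx x1] /andP[sy y1] yx.
move: sy; rewrite le_eqVlt => /orP[/eqP sy|sy].
  by rewrite -sy; apply: flux_lt_max; rewrite // ?in_itv /=; lra.
by apply: decr => //; rewrite in_itv /=; lra.
Qed.

(** The entropy flux of the single density [x] at level [k]; it is convertible
    to the local function [q] inside [entropy_flux]. *)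
Definition entropy_term {R : realType} (f : R -> R) (k x : R) : R :=
  Num.sg (x - k) * (f x - f k).

Lemma entropy_term_ge (R : realType) (f : R -> R) (k x : R) :
  k <= x -> entropy_term f k x = f x - f k.
Proof.
rewrite /entropy_term le_eqVlt => /orP[/eqP->|kx]; first by rewrite !subrr mulr0.
by rewrite gtr0_sg ?subr_gt0 // mul1r.
Qed.

Lemma entropy_term_le (R : realType) (f : R -> R) (k x : R) :
  x <= k -> entropy_term f k x = f k - f x.
Proof.
rewrite /entropy_term le_eqVlt => /orP[/eqP->|xk]; first by rewrite !subrr mulr0.
by rewrite ltr0_sg ?subr_lt0 // mulN1r opprB.
Qed.

Lemma entropy_term_left (R : realType) (f : R -> R) (sigma k x : R) :
  is_flux f sigma -> k \in `[0, sigma] -> x \in `[0, sigma] ->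
  entropy_term f k x = `|f x - f k|.
Proof.
move=> fl ks xs; have [kx|/ltW xk] := leP k x.
  by rewrite entropy_term_ge // ger0_norm // subr_ge0 (flux_le_left _ _ _ fl).
by rewrite entropy_term_le // ler0_norm ?opprB // subr_le0 (flux_le_left _ _ _ fl).
Qed.

Lemma entropy_term_right (R : realType) (f : R -> R) (sigma k x : R) :
  is_flux f sigma -> k \in `[sigma, 1] -> x \in `[sigma, 1] ->
  entropy_term f k x = - `|f x - f k|.
Proof.
move=> fl ks xs; have [kx|/ltW xk] := leP k x.
  rewrite entropy_term_ge // ler0_norm ?opprK // subr_le0.
  by rewrite (flux_le_right _ _ _ fl).
by rewrite entropy_term_le // ger0_norm ?opprB // subr_ge0 (flux_le_right _ _ _ fl).
Qed.

Lemma dist_majorization (R : realType) (a b c d k : R) :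
  a <= c -> a <= d -> a + b = c + d ->
  `|c - k| + `|d - k| <= `|a - k| + `|b - k|.
Proof.
move=> ac ad abcd.
case: (ger0P (c - k)); case: (ger0P (d - k)); case: (ger0P (a - k));
  case: (ger0P (b - k)); lra.
Qed.

Lemma bad_in_others_good (R : realType) (sigma : R) (r : node_data R) :
  in_unit r -> num_bad sigma r = 1%N -> rho1 r < sigma ->
  [/\ sigma <= rho2 r, rho3 r <= sigma & rho4 r <= sigma].
Proof.
case; rewrite /num_bad /bad_in /bad_out !in_itv /=.
move=> /andP[-> _] /andP[-> _] /andP[_ ->] /andP[_ ->] /=.
rewrite !andbT => num_bad1 r1; rewrite r1 in num_bad1.
by move: num_bad1; do 3! [case: ltP => ?].
Qed.

Lemma bad_out_others_good (R : realType) (sigma : R) (r : node_data R) :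
  in_unit r -> num_bad sigma r = 1%N -> sigma < rho4 r ->
  [/\ sigma <= rho1 r, sigma <= rho2 r & rho3 r <= sigma].
Proof.
case; rewrite /num_bad /bad_in /bad_out !in_itv /=.
move=> /andP[-> _] /andP[-> _] /andP[_ ->] /andP[_ ->] /=.
rewrite !andbT => num_bad1 r4; rewrite r4 in num_bad1.
by move: num_bad1; do 3! [case: ltP => ?].
Qed.

Theorem proposition4p3 (R : realType) (f : R -> R) (sigma : R) (tau : R -> R)
    (RS : node_data R -> node_data R) (r : node_data R)
    (f_flux : is_flux f sigma)
    (tauP : is_tau f sigma tau)
    (RSP : riemann_solver f sigma tau RS)
    (r_eq : equilibrium RS r)
    (r12 : rho1 r <= rho2 r)
    (r34 : rho3 r <= rho4 r)
    (r_good : num_good sigma r = 3%N)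
    (r_bad : num_bad sigma r = 1%N) :
  (rho1 r < sigma ->
    (E1 f RS ->
      [/\ rho2 r = sigma,
          rho3 r \in `[rho1 r, sigma] & rho4 r \in `[rho1 r, sigma]]) /\
    ([/\ rho2 r = sigma,
         rho3 r \in `[rho1 r, sigma] & rho4 r \in `[rho1 r, sigma]] ->
      forall k : R, k \in `[0, 1] -> 0 <= entropy_flux f r k)) /\
  (sigma < rho4 r ->
    (E1 f RS ->
      [/\ rho3 r = sigma,
          rho1 r \in `[sigma, rho4 r] & rho2 r \in `[sigma, rho4 r]]) /\
    ([/\ rho3 r = sigma,
         rho1 r \in `[sigma, rho4 r] & rho2 r \in `[sigma, rho4 r]] ->
      forall k : R, k \in `[0, 1] -> 0 <= entropy_flux f r k)).
Proof.
have [r_unit RSr] := r_eq.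
have [_ + _ _] := RSP r r_unit; rewrite RSr => mass.
have fluxE k : entropy_flux f r k =
    (entropy_term f k (rho1 r) + entropy_term f k (rho2 r)) -
    (entropy_term f k (rho3 r) + entropy_term f k (rho4 r)) by [].
have [[+ _ _] _] := flux_unimodal f_flux.
rewrite in_itv /= => /andP[s0 s1].
have s01 : sigma \in `[0, 1] by rewrite in_itv /= !ltW.
have E1_sigma : E1 f RS -> 0 <= entropy_flux f r sigma.
  by move=> /(_ r sigma r_unit s01); rewrite RSr.
have [u1 u2 u3 u4] := r_unit.
have le_max x : x \in `[0, 1] -> f x <= f sigma := @flux_le_max _ _ _ x f_flux.
have := (le_max _ u1, le_max _ u2, le_max _ u3, le_max _ u4).
move=> [[[f1 f2] f3] f4].
move: (u1) (u2) (u3) (u4); rewrite !in_itv /=.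
move=> /andP[a1 b1] /andP[a2 b2] /andP[a3 b3] /andP[a4 b4].
split=> [bad1|bad4].
- have [g2 g3 g4] := bad_in_others_good _ _ _ r_unit r_bad bad1.
  split=> [/E1_sigma|[r2 /andP[l3 _] /andP[l4 _]] k].
  + rewrite fluxE (entropy_term_ge _ _ _ _ g2).
    rewrite !entropy_term_le ?(ltW bad1) // => Fs.
    have r2 : rho2 r = sigma by apply: (flux_max_unique _ _ _ _ f_flux u2); lra.
    rewrite r2 in mass.
    have l13 : rho1 r <= rho3 r.
      by rewrite -(flux_le_left _ _ _ f_flux) ?in_itv /=; lra.
    by split=> //; lra.
  + rewrite in_itv /= fluxE => /andP[k0 k1]; have [ks|/ltW sk] := leP k sigma.
      rewrite !(entropy_term_left _ _ _ _ _ f_flux) ?in_itv /=; try lra.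
      rewrite subr_ge0; apply: dist_majorization => //;
        by rewrite (flux_le_left _ _ _ f_flux) ?in_itv /=; lra.
    by rewrite !entropy_term_le; lra.
- have [g1 g2 g3] := bad_out_others_good _ _ _ r_unit r_bad bad4.
  split=> [/E1_sigma|[r3 /andP[_ l1] /andP[_ l2]] k].
  + rewrite fluxE (entropy_term_le _ _ _ _ g3).
    rewrite !entropy_term_ge ?(ltW bad4) // => Fs.
    have r3 : rho3 r = sigma by apply: (flux_max_unique _ _ _ _ f_flux u3); lra.
    rewrite r3 in mass.
    have l24 : rho2 r <= rho4 r.
      by rewrite -(flux_le_right _ _ _ f_flux) ?in_itv /=; lra.
    by split=> //; lra.
  + rewrite in_itv /= fluxE => /andP[k0 k1]; have [ks|/ltW sk] := leP k sigma.
      by rewrite !entropy_term_ge; lra.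
    rewrite !(entropy_term_right _ _ _ _ _ f_flux) ?in_itv /=; try lra.
    (* On the decreasing branch the widest pair of values is the outgoing one. *)
    suff : `|f (rho1 r) - f k| + `|f (rho2 r) - f k| <=
           `|f (rho4 r) - f k| + `|f (rho3 r) - f k| by lra.
    apply: dist_majorization; last by rewrite mass addrC.
      by rewrite (flux_le_right _ _ _ f_flux) ?in_itv /=; lra.
    by rewrite (flux_le_right _ _ _ f_flux) ?in_itv /=; lra.
Qed.
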